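(* Let $q=19^3$, let $\mathbf{F}_q=\mathbf{F}_{19}[c]$ with $c^3=8c^2+4c+11$, and let $$P(T)=T^5+(11+17c+9c^2)T^4+(3+7c+18c^2)T^3+(2+5c+6c^2)T^2+(3+3c+11c^2)T+(6+17c+5c^2)\in\mathbf{F}_q[T].$$ Set $$\mu(X)=X^5+5X^3+3X^2-4X-9\in\mathbf{F}_{19}[X],\qquad G=\mu(T^q-T)\in\mathbf{F}_q[T].$$ Then: (a) $G=\prod_{a\in\mathbf{F}_q}P(T-a)$; in particular $G$ is squarefree of degree $5\cdot 19^3=34295$, and it is a product of $6859$ distinct $c$-Wieferich primes of degree $5$; (b) $G$ divides $[5]$ and $G$ divides $M_5$; hence $G\mid\gcd([5],M_5)$ in $\mathbf{F}_q[T]$.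
   Context: Let $q$ be a power of an odd prime $p$ and $A=\mathbf{F}_q[T]$. For $n\ge 1$ put $[n]=T^{q^n}-T\in A$. The Carlitz module is the $\mathbf{F}_q$-algebra homomorphism $\rho\colon A\to A\{\tau\}$ into the twisted polynomial ring (with $\tau x=x^q\tau$ for $x\in A$) determined by $\rho_T=T+\tau$. For $a\in A$, $\rho_a(x)$ denotes the associated $\mathbf{F}_q$-linear polynomial: if $\rho_a=\sum_i a_i\tau^i$ then $\rho_a(x)=\sum_i a_i x^{q^i}$; so $\rho_a(1)=\sum_i a_i$. A ''prime'' of $A$ is an irreducible polynomial. A monic prime $P\in A$ is called a $c$-Wieferich prime (to base $1$) if $\rho_P(1)\equiv 1\pmod{P^2}$. (The letter $c$ in ''$c$-Wieferich'' is part of the name and is unrelated to the element $c$ of $\mathbf{F}_{19^3}$.) For $d\ge 1$ define $$M_d=\sum_{k=0}^{d-1}(-1)^k[d-1][d-2]\cdots[d-k]\in A,$$ the $k=0$ term being $1$. *)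

(* Defs.v *)
From HB Require Import structures.
From mathcomp Require Import all_boot all_order all_fingroup all_algebra.
From mathcomp Require Import all_solvable all_field.

Set Implicit Arguments.
Unset Strict Implicit.
Unset Printing Implicit Defensive.

Import GRing.Theory.
Local Open Scope ring_scope.

(* The twisted polynomial ring A{tau} over A = {poly F}, with q = #|F|.       *)
(* The element f : twisted F stands for \sum_i f`_i tau^i; its multiplication *)
(* is the one determined by tau * x = x ^+ q * tau for x in A.                *)
Definition twisted (F : finFieldType) : Type := {poly {poly F}}.

HB.instance Definition _ (F : finFieldType) :=
  GRing.Zmodule.copy (twisted F) {poly {poly F}}.

Definition twisted_mul (F : finFieldType) (f g : twisted F) : twisted F :=
  \poly_(k < size (f : {poly {poly F}}) + size (g : {poly {poly F}}))
     \sum_(j < k.+1) f`_j * g`_(k - j) ^+ (#|F| ^ j).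

Lemma twisted_frobD (F : finFieldType) (j : nat) :
  {morph (fun x : {poly F} => x ^+ (#|F| ^ j)) : x y / x + y}.
Proof.
move=> x y; apply: exprDn_pchar; rewrite pnatX; apply/orP; left.
have [p p_pr Fp] := finPcharP F.
rewrite (eq_pnat _ (pchar_poly F)) (eq_pnat _ (pcharf_eq Fp)) -cardsT.
exact: (abelem_pgroup (fin_ring_pchar_abelem Fp)).
Qed.

Lemma twisted_frob0 (F : finFieldType) (j : nat) :
  0 ^+ (#|F| ^ j) = 0 :> {poly F}.
Proof.
by rewrite expr0n expn_eq0 -leqn0 leqNgt ltnW ?finNzRing_gt1.
Qed.

Lemma twisted_frobC (F : finFieldType) (j : nat) (a : F) :
  a%:P ^+ (#|F| ^ j) = a%:P :> {poly F}.
Proof.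
elim: j => [|j IHj]; first by rewrite expr1.
by rewrite expnS exprM -polyC_exp expf_card IHj.
Qed.

Lemma twisted_frob_sum (F : finFieldType) (j : nat) (I : Type) (r : seq I)
    (G : I -> {poly F}) :
  (\sum_(i <- r) G i) ^+ (#|F| ^ j) = \sum_(i <- r) G i ^+ (#|F| ^ j).
Proof. exact: (big_morph _ (@twisted_frobD F j) (@twisted_frob0 F j)). Qed.

Lemma coef_twisted_mul (F : finFieldType) (f g : twisted F) (k : nat) :
  (twisted_mul f g)`_k = \sum_(j < k.+1) f`_j * g`_(k - j) ^+ (#|F| ^ j).
Proof.
rewrite coef_poly; case: leqP => // le_fg_k; rewrite big1 // => j _.
have [le_f_j | lt_j_f] := leqP (size (f : {poly {poly F}})) j.
  by rewrite [f`__]nth_default ?mul0r.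
rewrite [g`__]nth_default ?twisted_frob0 ?mulr0 //.
rewrite -(leq_add2l j) subnKC ?leq_ord //.
by rewrite (leq_trans _ le_fg_k) // leq_add2r ltnW.
Qed.

Lemma twisted_mulA (F : finFieldType) : associative (@twisted_mul F).
Proof.
move=> f g h; apply/polyP=> i; rewrite coef_twisted_mul.
pose C j m := f`_j * g`_(m - j) ^+ (#|F| ^ j) * h`_(i - m) ^+ (#|F| ^ m).
transitivity (\sum_(j < i.+1) \sum_(m < i.+1 | (j <= m)%N) C j m).
  apply: eq_bigr => /= j _; rewrite coef_twisted_mul twisted_frob_sum mulr_sumr.
  rewrite -(big_mkord (fun m => j <= m)%N (C j)).
  have := @big_nat_widenl _ 0 +%R j 0 i.+1 predT (C j) (leq0n _).
  rewrite /= => <-; rewrite -[X in \sum_(X <= _ < _) _]add0n big_addn subSn ?leq_ord //.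
  rewrite big_mkord; apply: eq_bigr => l _; rewrite /C addnK exprMn mulrA.
  by rewrite -exprM -expnD -subnDA [(j + l)%N]addnC.
rewrite (exchange_big_dep predT) //= coef_twisted_mul; apply: eq_bigr => m _.
rewrite coef_twisted_mul mulr_suml.
by rewrite (big_ord_narrow_leq (leq_ord m)).
Qed.

Lemma twisted_mul1l (F : finFieldType) :
  left_id (1%:P : twisted F) (@twisted_mul F).
Proof.
move=> f; apply/polyP=> k; rewrite coef_twisted_mul big_ord_recl subn0 coefC.
rewrite mul1r expr1 big1 ?addr0 // => j _.
by rewrite coefC mul0r.
Qed.

Lemma twisted_mul1r (F : finFieldType) :
  right_id (1%:P : twisted F) (@twisted_mul F).
Proof.
move=> f; apply/polyP=> k; rewrite coef_twisted_mul big_ord_recr /= subnn.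
rewrite coefC expr1n mulr1 big1 ?add0r // => j _.
by rewrite coefC eqn0Ngt subn_gt0 ltn_ord twisted_frob0 mulr0.
Qed.

Lemma twisted_mulDl (F : finFieldType) :
  left_distributive (@twisted_mul F) +%R.
Proof.
move=> f g h; apply/polyP=> k; rewrite coefD !coef_twisted_mul -big_split /=.
by apply: eq_bigr => j _; rewrite coefD mulrDl.
Qed.

Lemma twisted_mulDr (F : finFieldType) :
  right_distributive (@twisted_mul F) +%R.
Proof.
move=> f g h; apply/polyP=> k; rewrite coefD !coef_twisted_mul -big_split /=.
by apply: eq_bigr => j _; rewrite coefD twisted_frobD mulrDr.
Qed.

HB.instance Definition _ (F : finFieldType) :=
  GRing.Zmodule_isNzRing.Build (twisted F) (@twisted_mulA F)
    (@twisted_mul1l F) (@twisted_mul1r F) (@twisted_mulDl F)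
    (@twisted_mulDr F) (oner_neq0 {poly {poly F}}).

Definition twisted_scale (F : finFieldType) (a : F) (f : twisted F) :
  twisted F := a%:P *: (f : {poly {poly F}}).

Lemma twisted_scaleA (F : finFieldType) (a b : F) (f : twisted F) :
  twisted_scale a (twisted_scale b f) = twisted_scale (a * b) f.
Proof. by rewrite /twisted_scale scalerA -polyCM. Qed.

Lemma twisted_scale1 (F : finFieldType) : left_id 1 (@twisted_scale F).
Proof. by move=> f; apply: scale1r. Qed.

Lemma twisted_scaleDr (F : finFieldType) :
  right_distributive (@twisted_scale F) +%R.
Proof. by move=> a f g; apply: scalerDr. Qed.

Lemma twisted_scaleDl (F : finFieldType) (f : twisted F) :
  {morph (@twisted_scale F)^~ f : a b / a + b}.
Proof. by move=> a b; rewrite /twisted_scale polyCD; apply: scalerDl. Qed.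

HB.instance Definition _ (F : finFieldType) :=
  GRing.Zmodule_isLmodule.Build F (twisted F) (@twisted_scaleA F)
    (@twisted_scale1 F) (@twisted_scaleDr F) (@twisted_scaleDl F).

Lemma twisted_scaleAl (F : finFieldType) (a : F) (f g : twisted F) :
  a *: (f * g) = (a *: f) * g.
Proof.
apply/polyP=> k; rewrite coefZ !coef_twisted_mul mulr_sumr.
by apply: eq_bigr => j _; rewrite coefZ mulrA.
Qed.

HB.instance Definition _ (F : finFieldType) :=
  GRing.Lmodule_isLalgebra.Build F (twisted F) (@twisted_scaleAl F).

Lemma twisted_scaleAr (F : finFieldType) (a : F) (f g : twisted F) :
  a *: (f * g) = f * (a *: g).
Proof.
apply/polyP=> k; rewrite coefZ !coef_twisted_mul mulr_sumr.
by apply: eq_bigr => j _; rewrite coefZ exprMn twisted_frobC mulrCA.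
Qed.

HB.instance Definition _ (F : finFieldType) :=
  GRing.Lalgebra_isAlgebra.Build F (twisted F) (@twisted_scaleAr F).

Definition twistedC (F : finFieldType) (x : {poly F}) : twisted F :=
  (x%:P : {poly {poly F}}).

Definition tau (F : finFieldType) : twisted F := ('X : {poly {poly F}}).

Lemma coef_twistedC_mul (F : finFieldType) (x : {poly F}) (f : twisted F)
    (k : nat) : (twistedC x * f)`_k = x * f`_k.
Proof.
rewrite coef_twisted_mul big_ord_recl subn0 coefC expr1 big1 ?addr0 // => j _.
by rewrite coefC mul0r.
Qed.

Lemma tau_comm (F : finFieldType) (x : {poly F}) :
  tau F * twistedC x = twistedC (x ^+ #|F|) * tau F.
Proof.
apply/polyP=> k; rewrite coef_twistedC_mul coef_twisted_mul coefX.
case: k => [|k]; first by rewrite big_ord1 coefX mul0r mulr0.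
rewrite !big_ord_recl coefX mul0r add0r big1 => [|j _]; last first.
  by rewrite coefX mul0r.
rewrite coefX mul1r addr0 expn1 subSS subn0 coefC eqSS.
case: (k == 0)%N; first by rewrite mulr1.
by rewrite mulr0 -[#|F|]expn1 twisted_frob0.
Qed.

(* horner_alg u is the unique morphism of F-algebras {poly F} -> twisted F    *)
(* mapping the variable T = 'X of A to u; here rho_T = T + tau.               *)
Definition carlitz (F : finFieldType) : {poly F} -> twisted F :=
  horner_alg (twistedC 'X + tau F).

HB.instance Definition _ (F : finFieldType) :=
  GRing.RMorphism.on (@carlitz F).

Lemma carlitz_is_scalable (F : finFieldType) : scalable (@carlitz F).
Proof.
move=> a P; have Ca : carlitz a%:P = a%:A by apply: horner_algC.
by rewrite -mul_polyC rmorphM /= Ca mulr_algl.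
Qed.

HB.instance Definition _ (F : finFieldType) :=
  GRing.isScalable.Build F {poly F} (twisted F) *:%R (@carlitz F)
    (@carlitz_is_scalable F).

Definition twisted_eval (F : finFieldType) (f : twisted F) (x : {poly F}) :
    {poly F} :=
  \sum_(i < size (f : {poly {poly F}})) f`_i * x ^+ (#|F| ^ i).

Definition c_Wieferich (F : finFieldType) (P : {poly F}) : Prop :=
  [/\ P \is monic, irreducible_poly P
    & P ^+ 2 %| twisted_eval (carlitz P) 1 - 1].

(* This excludes G = 0, which every square divides.                           *)
Definition squarefree (F : fieldType) (G : {poly F}) : Prop :=
  forall u : {poly F}, u ^+ 2 %| G -> size u = 1%N.

Definition bracket (F : finFieldType) (n : nat) : {poly F} :=
  'X^(#|F| ^ n) - 'X.

Definition M (F : finFieldType) (d : nat) : {poly F} :=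
  \sum_(k < d) (-1) ^+ k * \prod_(1 <= j < k.+1) bracket F (d - j).

Definition P5 (F : finFieldType) (c : F) : {poly F} :=
  'X^5 + (11 + 17 * c + 9 * c ^+ 2)%:P * 'X^4
  + (3 + 7 * c + 18 * c ^+ 2)%:P * 'X^3
  + (2 + 5 * c + 6 * c ^+ 2)%:P * 'X^2
  + (3 + 3 * c + 11 * c ^+ 2)%:P * 'X
  + (6 + 17 * c + 5 * c ^+ 2)%:P.

(* The coefficients are images of integers, so that over F of characteristic  *)
(* 19 this is the image in F[X] of a polynomial over the prime field 'F_19.   *)
Definition mu (F : finFieldType) : {poly F} :=
  'X^5 + 5 * 'X^3 + 3 * 'X^2 - 4 * 'X - 9.

Definition G5 (F : finFieldType) : {poly F} := mu F \Po ('X^#|F| - 'X).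

(* Main.v *)
Require Import Defs.
From mathcomp Require Import all_boot all_order all_algebra all_field.
From mathcomp Require Import all_fingroup all_solvable ring.

(** Write u = T^q - T, so that G = mu(u).  Every translation T |-> T - a with
a in F_q fixes u, hence fixes G; this symmetry spreads over the whole orbit of
P whatever is known for a single translate.

Part (b) takes place in F_19[X].  Telescoping gives [n] = B_n(u) with
B_n = \sum_(i < n) X^(q^i), and M_(d+1) = 1 - [d] M_d, so [5] and M_5 are
polynomials in u with coefficients in F_19, and it suffices that mu divides
these two polynomials in X.  Modulo mu, the power X^q is obtained by raising X
three times to the 19th power, so this is a short calculation with residues of
degree at most 4 over F_19 ([G_dvd_bracket], [G_dvd_M]).

The polynomial P is a translate P0(T - b) of a polynomial P0 over F_19.  The
reason is additive Hilbert 90: mu has trace 0, so a root of mu in F_(19^5) is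
x^q - x for some x in F_(19^5); if t is a root of P with t^q - t equal to that
root of mu, then t - x is fixed by the q-th power and lies in F_q.  That P0
divides G is once more a calculation over F_19 ([P0_dvd_G], [P5_translate]),
and so every P(T - a) divides G.

An irreducible factor Q of G has degree divisible by 5 ([dvd5_degree_factor]).
Indeed, the class t of T modulo Q is fixed by the q^5-power map because
G | [5], and by the q^(deg Q)-power map; were deg Q prime to 5, then t^q = t,
so u would vanish modulo Q and mu(0) would be 0.  Thus the P(T - a), of degree
5, are irreducible.  They are distinct, their second coefficients being so, and
a comparison of degrees shows that G is their product.  As [5] has derivative
-1, its divisor G is squarefree.

That they are c-Wieferich follows from Thakur's criterion
([Wieferich_criterion]): for a monic prime P of degree d, P | M_d implies that
P is c-Wieferich.  Put w_j = rho_(T^j)(1), so that w_0 = 1 and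
w_(j+1) = T w_j + w_j^q, and consider the A-linear forms L_k on A[Y] sending
Y^j to w_j^(q^k).  The recursion for w_j becomes
   L_k((Y - s) R) = (T^(q^k) - s) L_k(R) + L_(k+1)(R).
Taking s = T^(q^k) kills the first term; so L_k maps the product of the
Y - T^(q^i), k <= i < k + n, to 1, and L_0 maps the product of the
Y - T^(q^i), 1 <= i < d, to M_d, which obeys the same recursion.  Modulo P one
has P(Y) = \prod_(i < d) (Y - T^(q^i)), whence rho_P(1) = L_0(P(Y)) = 1.
Differentiation annihilates q-th powers, so the form sending Y^j to w_j' takes
the value L_0(R) at (Y - T) R, and the derivative of rho_P(1) is congruent to
M_d modulo P.  A polynomial that vanishes modulo P together with its
derivative vanishes modulo P^2, because P is separable. *)

Set Implicit Arguments.
Unset Strict Implicit.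
Unset Printing Implicit Defensive.

Import GRing.Theory.
Local Open Scope ring_scope.

(** * Preliminaries on polynomials *)

Lemma in_qpoly_eq0 (F : fieldType) (h p : {poly F}) :
  (1 < size h)%N -> h \is monic -> (in_qpoly h p == 0) = (h %| p).
Proof.
move=> h_gt1 h_monic; rewrite -val_eqE /= /mk_monic h_gt1 h_monic /=.
by rewrite -Pdiv.IdomainMonic.modpE.
Qed.

Lemma size_Xn_subX (R : nzRingType) n :
  (1 < n)%N -> size ('X^n - 'X : {poly R}) = n.+1.
Proof.
by move=> n_gt1; rewrite size_polyDl size_polyXn // size_polyN size_polyX.
Qed.

Lemma natr_card_eq0 (F : finFieldType) : #|F|%:R = 0 :> F.
Proof.
by rewrite -FinRing.zmodXgE -cardsT (@cyclic.expg_cardG _ [set: F]%G) ?inE.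
Qed.

(** * Linear forms on a polynomial ring *)

(** A B-linear form on polynomials is the same thing as the sequence w of its
values on the powers of the variable. *)
Definition umbral (B : comNzRingType) (w : nat -> B) (R : {poly B}) : B :=
  \sum_(j < size R) R`_j * w j.

Section Umbral.
Variable B : comNzRingType.
Implicit Types (w v : nat -> B) (R S : {poly B}).

Lemma umbral_wide n w R :
  (size R <= n)%N -> umbral w R = \sum_(j < n) R`_j * w j.
Proof.
move=> leRn; rewrite /umbral (big_ord_widen n (fun j => R`_j * w j)) //.
rewrite big_mkcond; apply: eq_bigr => j _.
by case: ltnP => // leRj; rewrite nth_default ?mul0r.
Qed.

Lemma eq_umbral w v R : w =1 v -> umbral w R = umbral v R.
Proof. by move=> eqwv; apply: eq_bigr => j _; rewrite eqwv. Qed.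

Lemma umbral1 w : umbral w 1 = w 0%N.
Proof. by rewrite /umbral size_poly1 big_ord1 coef1 mul1r. Qed.

Lemma umbral_XsubC w s R :
  umbral w (('X - s%:P) * R) = umbral (fun j => w j.+1) R - s * umbral w R.
Proof.
have [-> | nzR] := eqVneq R 0.
  by rewrite mulr0 /umbral size_poly0 !big_ord0 mulr0 subr0.
have sz: (size (('X - s%:P) * R)%R <= (size R).+1)%N.
  by rewrite (leq_trans (size_polyMleq _ _)) // size_XsubC.
rewrite (umbral_wide _ sz) (umbral_wide w (leqnSn (size R))) mulr_sumr.
have -> : umbral (fun j => w j.+1) R =
          \sum_(j < (size R).+1) ('X * R)`_j * w j.
  rewrite big_ord_recl coefXM mul0r add0r.
  by apply: eq_bigr => j _; rewrite coefXM.
rewrite -sumrB; apply: eq_bigr => j _.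
by rewrite mulrBl coefB coefCM mulrBl mulrA.
Qed.

Lemma umbral_combine a w v R :
  umbral (fun j => a * w j + v j) R = a * umbral w R + umbral v R.
Proof.
rewrite /umbral mulr_sumr -big_split; apply: eq_bigr => j _ /=.
by rewrite mulrDr mulrCA.
Qed.

End Umbral.

Lemma umbral_map (B K : comNzRingType) (f : {rmorphism B -> K}) w
    (R : {poly B}) :
  f (umbral w R) = umbral (f \o w) (map_poly f R).
Proof.
rewrite [RHS](@umbral_wide _ (size R)) ?size_poly // rmorph_sum.
by apply: eq_bigr => j _; rewrite rmorphM coef_map.
Qed.

(** * The Carlitz module at 1 *)

Section Carlitz.
Variable F : finFieldType.
Local Notation q := #|F|.
Local Notation A := {poly F}.
Implicit Types (P : A) (R : {poly A}).

(** These are the values rho_(T^j)(1), see [carlitz_orbitE]. *)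
Fixpoint carlitz_orbit (j : nat) : A :=
  if j is i.+1 then 'X * carlitz_orbit i + carlitz_orbit i ^+ q else 1.

Lemma twisted_eval1 (f : twisted F) :
  twisted_eval f 1 = (f : {poly A}).[1].
Proof.
by rewrite horner_coef; apply: eq_bigr => i _; rewrite !expr1n.
Qed.

Lemma tau_mul_coef (f : twisted F) k :
  (tau F * f)`_k = if k is i.+1 then f`_i ^+ q else 0.
Proof.
rewrite coef_twisted_mul; case: k => [|k].
  by rewrite big_ord1 coefX mul0r.
rewrite !big_ord_recl coefX mul0r add0r coefX mul1r subSS subn0 expn1.
by rewrite big1 ?addr0 // => j _; rewrite coefX mul0r.
Qed.

Lemma carlitz_orbitE j :
  twisted_eval ((twistedC 'X + tau F) ^+ j) 1 = carlitz_orbit j.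
Proof.
elim: j => [|j IHj]; first by rewrite twisted_eval1 expr0 hornerC.
rewrite exprS mulrDl; set f := _ ^+ j in IHj *.
rewrite twisted_eval1 hornerD /= -IHj twisted_eval1; congr (_ + _).
  have -> : twistedC 'X * f = 'X *: (f : {poly A}).
    by apply/polyP=> k; rewrite coef_twistedC_mul coefZ.
  by rewrite hornerZ.
have -> : tau F * f = map_poly (fun x : A => x ^+ q) (f : {poly A}) * 'X.
  apply/polyP=> k; rewrite tau_mul_coef coefMX; case: k => //= k.
  by rewrite coef_map_id0 // -[q]expn1 twisted_frob0.
have szf : (size (map_poly (fun x : A => x ^+ q) (f : {poly A})) <=
            size (f : {poly A}))%N by apply: size_poly.
rewrite hornerMX mulr1 (horner_coef_wide 1 szf) horner_coef.
rewrite -[X in _ = _ ^+ X]expn1 twisted_frob_sum expn1.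
apply: eq_bigr => i _; rewrite !expr1n !mulr1 coef_map_id0 //.
by rewrite -[q]expn1 twisted_frob0.
Qed.

Lemma carlitz_eval1 P :
  twisted_eval (carlitz P) 1 = umbral carlitz_orbit (map_poly polyC P).
Proof.
have -> : carlitz P = \sum_(i < size P) P`_i *: (twistedC 'X + tau F) ^+ i.
  rewrite -{1}[P]coefK poly_def linear_sum; apply: eq_bigr => i _.
  by rewrite linearZ /= rmorphXn /= /carlitz horner_algX.
rewrite twisted_eval1 (big_morph (fun f : twisted F => (f : {poly A}).[1])
                        (fun f g => hornerD f g 1) (horner0 1)).
rewrite (@umbral_wide _ (size P)) ?size_poly //.
by apply: eq_bigr => i _; rewrite coef_map hornerZ -carlitz_orbitE twisted_eval1.
Qed.

End Carlitz.

(** * A criterion for c-Wieferich primes *)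

Section Orbit.
Variable F : finFieldType.
Local Notation q := #|F|.
Local Notation A := {poly F}.
Implicit Types (P : A) (R : {poly A}).
Local Notation w := (carlitz_orbit F).

Local Notation XsubT i := ('X - ('X^(q ^ i))%:P : {poly A}).

(** The forms sending Y^j to w_j^(q^k) are linked by the q^k-th power of the
recursion w_(j+1) = T w_j + w_j^q. *)
Lemma umbral_orbit_step k s R :
  umbral (fun j => w j ^+ (q ^ k)) (('X - s%:P) * R) =
    ('X^(q ^ k) - s) * umbral (fun j => w j ^+ (q ^ k)) R
    + umbral (fun j => w j ^+ (q ^ k.+1)) R.
Proof.
rewrite umbral_XsubC mulrBl addrAC -umbral_combine; congr (_ - _).
apply: eq_umbral => j /=.
by rewrite twisted_frobD exprMn -exprM -expnS.
Qed.

(** The factor Y - T^(q^k) only shifts k to k + 1, and the next factor then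
meets the form for which it is again a pure shift. *)
Lemma umbral_orbit_prod k n :
  umbral (fun j => w j ^+ (q ^ k)) (\prod_(k <= i < k + n) XsubT i) = 1.
Proof.
elim: n k => [|n IHn] k.
  by rewrite addn0 big_geq // umbral1 expr1n.
rewrite big_ltn ?addnS ?ltnS ?leq_addr // umbral_orbit_step subrr mul0r add0r.
by rewrite -addSn IHn.
Qed.

Lemma M_rec d : M F d.+1 = 1 - bracket F d * M F d.
Proof.
case: d => [|d].
  by rewrite /M big_ord1 big_ord0 expr0 mul1r big_geq // mulr0 subr0.
rewrite /M big_ord_recl expr0 mul1r big_geq // mulr_sumr -sumrN.
congr (_ + _); apply: eq_bigr => k _; rewrite lift0 exprS mulN1r mulNr.
rewrite big_ltn // subn1 mulrCA; congr (- (_ * (_ * _))).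
by rewrite big_add1; apply: eq_bigr => i _.
Qed.

(** Splitting off the last factor Y - T^(q^d) multiplies the value by -[d] and
adds the shifted value, which is 1 by [umbral_orbit_prod]: this is the
recursion of [M_rec]. *)
Lemma umbral_orbit_M d :
  umbral w (\prod_(1 <= i < d.+1) XsubT i) = M F d.+1.
Proof.
have w0 R : umbral w R = umbral (fun j => w j ^+ (q ^ 0)) R.
  by apply: eq_umbral => j; rewrite expr1.
elim: d => [|d IHd].
  by rewrite big_geq // umbral1 M_rec /M big_ord0 mulr0 subr0.
rewrite big_nat_recr //= mulrC w0 umbral_orbit_step -w0 IHd.
by rewrite -[d.+1]add1n umbral_orbit_prod M_rec expr1 -opprB mulNr addrC.
Qed.

Lemma deriv_expq (x : A) : (x ^+ q)^`() = 0.
Proof.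
by rewrite deriv_exp -mulr_natr -polyC_natr natr_card_eq0 polyC0 mulr0.
Qed.

(** Since q-th powers have derivative 0, w_(j+1)' = w_j + T w_j'. *)
Lemma umbral_deriv_orbit R :
  umbral (fun j => (w j)^`()) (('X - 'X%:P) * R) = umbral w R.
Proof.
rewrite umbral_XsubC; apply/eqP; rewrite subr_eq addrC -umbral_combine; apply/eqP.
apply: eq_umbral => j /=.
by rewrite derivD derivM derivX mul1r deriv_expq addr0 addrC.
Qed.

Lemma deriv_umbral_polyC v P :
  (umbral v (map_poly polyC P))^`() =
  umbral (fun j => (v j)^`()) (map_poly polyC P).
Proof.
rewrite /umbral linear_sum; apply: eq_bigr => j _ /=.
by rewrite coef_map derivM derivC mul0r add0r.
Qed.

Lemma comp_polyXq P j : P \Po 'X^(q ^ j) = P ^+ (q ^ j).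
Proof.
elim/poly_ind: P => [|P c IH]; first by rewrite comp_poly0 twisted_frob0.
rewrite comp_polyD comp_polyM comp_polyX comp_polyC IH.
by rewrite twisted_frobD exprMn twisted_frobC.
Qed.

End Orbit.

Section Residue.
Variables (F : finFieldType) (P : {poly F}).
Hypotheses (P_irr : irreducible_poly P) (P_monic : P \is monic).
Local Notation q := #|F|.
Local Notation A := {poly F}.
Let P_mi : monic_irreducible_poly P := (P_irr, P_monic).
Local Notation K := {poly %/ P with P_mi}.
Let d := (size P).-1.
Local Notation res := (in_qpoly P : A -> K).

Lemma res_eq0 (f : A) : (res f == 0) = (P %| f).
Proof. by apply: in_qpoly_eq0 => //; case: P_irr. Qed.

Lemma dvd_expq_subr (f : A) : P %| f ^+ (q ^ d) - f.
Proof.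
rewrite -res_eq0 rmorphB rmorphXn /= subr_eq0 -(card_qfpoly P_mi).
by apply/eqP/expf_card.
Qed.

(** If P divided [e], the q^e-th power map, which commutes with polynomials over
F, would fix all q^d elements of F[T]/(P); but T^(q^e) - T has at most q^e
roots in that field. *)
Lemma dvd_bracket_min e : (0 < e < d)%N -> ~~ (P %| bracket F e).
Proof.
case/andP=> e_gt0 lt_ed; apply/negP; rewrite -res_eq0 rmorphB /= subr_eq0.
move/eqP=> Te.
have fix_all (y : K) : root ('X^(q ^ e) - 'X) y.
  have -> : y = res (val y).
    by apply/val_inj; rewrite [RHS]in_qpoly_small // size_mk_monic.
  rewrite /root !hornerE subr_eq0 -rmorphXn /= -comp_polyXq.
  by rewrite in_qpoly_comp_horner Te -in_qpoly_comp_horner comp_polyXr.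
have q_gt1 : (1 < q)%N by apply: finNzRing_gt1.
have sz : size ('X^(q ^ e) - 'X : {poly K}) = (q ^ e).+1.
  by rewrite size_Xn_subX // -[X in (X < _)%N](expn0 q) ltn_exp2l.
have nz : ('X^(q ^ e) - 'X : {poly K}) != 0 by rewrite -size_poly_gt0 sz.
have all_r : all (root ('X^(q ^ e) - 'X)) (enum K) by apply/allP=> y _.
have := max_poly_roots nz all_r (enum_uniq _).
by rewrite sz -cardE card_qfpoly ltnS leq_exp2l // leqNgt lt_ed.
Qed.

(** The conjugates T^(q^i), i < d, are roots of P modulo P, and they are distinct
by [dvd_bracket_min]. *)
Lemma map_res_prod :
  map_poly res (map_poly polyC P) =
  map_poly res (\prod_(0 <= i < d) ('X - ('X^(q ^ i))%:P)).
Proof.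
have -> : map_poly res (map_poly polyC P) = map_poly (qfpoly_const P_mi) P.
  rewrite -map_poly_comp; apply: eq_map_poly => a /=.
  apply/val_inj; rewrite [LHS]in_qpoly_small //.
  exact: leq_ltn_trans (size_polyC_leq1 _) (size_mk_monic_gt1 _).
pose t i : K := res 'X^(q ^ i).
rewrite rmorph_prod /=.
under eq_bigr => i _ do rewrite rmorphB /= map_polyX map_polyC /=.
rewrite -(big_map t predT (fun x => 'X - x%:P)) /=.
set rs := map t _.
have lcP : lead_coef (map_poly (qfpoly_const P_mi) P) = 1.
  by rewrite lead_coef_map (eqP P_monic) rmorph1.
rewrite [LHS](@all_roots_prod_XsubC _ _ rs) ?lcP ?scale1r //.
- rewrite size_map_poly size_map size_iota subn0 /d prednK //.
  by rewrite ltnW //; case: P_irr.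
- apply/allP=> _ /mapP[i _ ->]; apply/eqP.
  rewrite /t -[LHS]in_qpoly_comp_horner comp_polyXq rmorphXn /=.
  have -> : res P = 0 by apply/eqP; rewrite res_eq0.
  by rewrite expr0n expn_eq0 -leqn0 leqNgt ltnW ?finNzRing_gt1.
rewrite uniq_rootsE map_inj_in_uniq ?iota_uniq // => i j.
rewrite !mem_index_iota !leq0n /=.
wlog le_ij : i j / (i <= j)%N => [IH lti ltj eqt | _ ltj eqt].
  have [/IH|/ltnW/IH] := leqP i j; first exact.
  by move/(_ ltj lti (esym eqt)).
apply/eqP; rewrite eqn_leq le_ij leqNgt; apply/negP=> lt_ij.
suff : P %| bracket F (d - (j - i)).
  apply/negP; apply: dvd_bracket_min.
  rewrite subn_gt0 ltn_subrL subn_gt0 lt_ij (leq_ltn_trans (leq_subr _ _)) //=.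
  exact: leq_trans ltj.
(* Raising both sides to this power turns the class of T^(q^j) back into T. *)
have := congr1 (fun x => x ^+ (q ^ (d - j))) eqt.
rewrite /t -!rmorphXn -!exprM -!expnD (subnKC (ltnW ltj)) => eqd.
rewrite -res_eq0 rmorphB subr_eq0 /= subnBA // addnC.
rewrite addnBA in eqd; last exact: ltnW.
rewrite eqd -subr_eq0 -rmorphB res_eq0; exact: dvd_expq_subr.
Qed.

Lemma dvd_umbral_split w :
  P %| umbral w (map_poly polyC P)
       - umbral w (\prod_(0 <= i < d) ('X - ('X^(q ^ i))%:P)).
Proof.
by rewrite -res_eq0 rmorphB subr_eq0 /= !umbral_map map_res_prod.
Qed.

End Residue.

Lemma dvd_sqr_deriv (F : fieldType) (P f : {poly F}) :
  coprimep P P^`() -> P %| f -> P %| f^`() -> P ^+ 2 %| f.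
Proof.
move=> cPP' /dvdpP[g ->]; rewrite derivM dvdp_addr; last exact: dvdp_mulIr.
by rewrite Gauss_dvdpl // expr2 => Pg; apply: dvdp_mul.
Qed.

Section Wieferich.
Variable F : finFieldType.
Local Notation q := #|F|.

(** The derivative of [n] is the unit -1. *)
Lemma coprime_deriv_bracket (f : {poly F}) n :
  (0 < n)%N -> f %| bracket F n -> coprimep f f^`().
Proof.
case: n => // n _ /dvdpP[g def_b].
have : (bracket F n.+1)^`() = -1.
  by rewrite derivB derivX expnSr exprM deriv_expq sub0r.
rewrite def_b derivM => eqN1; apply/Bezout_coprimepP.
exists (- g^`(), - g); rewrite /= !mulNr -opprD eqN1 opprK; exact: eqpxx.
Qed.

Lemma squarefree_coprime_deriv (f : {poly F}) :
  coprimep f f^`() -> squarefree f.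
Proof.
move=> cff' u /dvdpP[g def_f]; apply/eqP; rewrite size_poly_eq1.
move: cff'; rewrite def_f derivM deriv_exp /= expr1 expr2 => /coprimepP; apply.
  by rewrite dvdp_mull // dvdp_mulr.
rewrite dvdp_add // ?dvdp_mull ?dvdp_mulr // -mulr_natr dvdp_mulr //.
by rewrite dvdp_mull.
Qed.

(** Modulo P, the product formula for P(Y) shows that rho_P(1) - 1 vanishes and
that its derivative is M_d. *)
Lemma Wieferich_criterion (P : {poly F}) :
  P \is monic -> irreducible_poly P -> P %| M F (size P).-1 -> c_Wieferich P.
Proof.
move=> P_monic P_irr PM; split=> //.
have d_gt0 : (0 < (size P).-1)%N by case: P_irr; case: (size P) => [|[]].
have Pb : P %| bracket F (size P).-1.
  by have := dvd_expq_subr P_irr P_monic 'X.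
apply: dvd_sqr_deriv; first exact: coprime_deriv_bracket Pb.
  have := dvd_umbral_split P_irr P_monic (carlitz_orbit F); rewrite carlitz_eval1.
  suff -> : umbral (carlitz_orbit F)
              (\prod_(0 <= i < (size P).-1) ('X - ('X^(q ^ i))%:P)) = 1 by [].
  rewrite -(umbral_orbit_prod F 0 (size P).-1).
  by apply: eq_umbral => j; rewrite expr1.
rewrite derivB derivC subr0 carlitz_eval1 deriv_umbral_polyC.
have := dvd_umbral_split P_irr P_monic (fun j => (carlitz_orbit F j)^`()).
rewrite big_ltn // expr1 umbral_deriv_orbit.
have -> : umbral (carlitz_orbit F)
            (\prod_(1 <= i < (size P).-1) ('X - ('X^(q ^ i))%:P)) =
          M F (size P).-1 by rewrite -(prednK d_gt0) umbral_orbit_M.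
move=> Pd.
by rewrite -(subrK (M F (size P).-1) (umbral _ _)) dvdp_add.
Qed.

Definition artin_schreier : {poly F} := 'X^q - 'X.

(** On the extension of degree n of F this polynomial is the trace to F. *)
Definition trace_poly n : {poly F} := \sum_(i < n) 'X^(q ^ i).

(** The recursion of [M_rec], with trace_poly m in the place of [m]. *)
Fixpoint M_poly n : {poly F} :=
  if n is m.+1 then 1 - trace_poly m * M_poly m else 0.

(** The q^i-th powers of T^q - T telescope. *)
Lemma bracket_comp n : bracket F n = trace_poly n \Po artin_schreier.
Proof.
elim: n => [|n IHn].
  by rewrite /trace_poly big_ord0 comp_poly0 /bracket subrr.
rewrite /trace_poly big_ord_recr comp_polyD -IHn /= /bracket.
rewrite rmorphXn /= comp_polyX /artin_schreier.
have -> : ('X^q - 'X : {poly F}) ^+ (q ^ n) = 'X^(q ^ n.+1) - 'X^(q ^ n).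
  by apply/eqP; rewrite eq_sym subr_eq -twisted_frobD subrK -exprM -expnS.
by rewrite [RHS]addrC addrA subrK.
Qed.

Lemma M_comp n : M F n = M_poly n \Po artin_schreier.
Proof.
elim: n => [|n IHn]; first by rewrite comp_poly0 /M big_ord0.
by rewrite M_rec /= comp_polyB comp_polyM -IHn -bracket_comp comp_polyC.
Qed.

Lemma artin_schreier_translate a : artin_schreier \Po ('X - a%:P) = artin_schreier.
Proof.
rewrite /artin_schreier comp_polyB comp_polyX comp_Xn_poly -[X in _ ^+ X]expn1.
have -> : ('X - a%:P) ^+ (q ^ 1) = 'X^q - a%:P.
  apply/eqP; rewrite eq_sym subr_eq -[X in _ == _ + X](twisted_frobC 1).
  by rewrite -twisted_frobD subrK expn1.
by rewrite opprB addrA subrK.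
Qed.

End Wieferich.

(** * Certified arithmetic of residues in characteristic p *)

(** Polynomials over the prime field are encoded by lists of natural numbers, so
that one list gives a polynomial over every ring. *)
Definition natpoly (R : nzRingType) (s : seq nat) : {poly R} :=
  Poly [seq a%:R | a <- s].

(** Residues modulo p and modulo the monic polynomial natpoly (rcons m 1), as
lists of natural numbers on which kernel reduction is effective.  The leading
coefficient is left out of m, so that size m is the degree. *)
Section ResArith.
Variables (p : nat) (m : seq nat).

Definition rscale a s : seq nat := [seq ((a * b) %% p)%N | b <- s].
Definition ropp s : seq nat := rscale p.-1 s.

Fixpoint radd (s t : seq nat) : seq nat :=
  match s, t with
  | a :: s', b :: t' => ((a + b) %% p)%N :: radd s' t'
  | [::], _ => t
  | _, [::] => s
  end.

(** A shift produces a new leading coefficient only when s has full length, and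
that coefficient is then folded back by the relation x^(size m) = - m(x). *)
Definition rmulX (s : seq nat) : seq nat :=
  if size s == size m then radd (belast 0 s) (rscale (last 0 s) (ropp m))
  else 0 :: s.

Definition rmul (s t : seq nat) : seq nat :=
  foldr (fun a acc => radd (rscale a t) (rmulX acc)) [::] s.

Definition rexp s n : seq nat := iter n (rmul s) [:: 1%N].

Definition rhorner (s t : seq nat) : seq nat :=
  foldr (fun a acc => radd [:: a] (rmul t acc)) [::] s.

(** The power map of exponent p^e; below, q = p^e. *)
Definition rfrob e (s : seq nat) : seq nat := iter e (rexp ^~ p) s.

(** The lists [rtrace] and [rM] compute [trace_poly] and [M_poly]. *)
Fixpoint rtrace e n : seq nat :=
  if n is k.+1 then radd (rtrace e k) (iter k (rfrob e) [:: 0; 1]%N) else [::].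

Fixpoint rM e n : seq nat :=
  if n is k.+1 then radd [:: 1%N] (ropp (rmul (rtrace e k) (rM e k)))
  else [::].

Variables (R : comNzRingType) (x : R).
Hypothesis p_gt0 : (0 < p)%N.
Hypothesis pR : p%:R = 0 :> R.
Let ev s := (natpoly R s).[x].
Hypothesis root_x : ev (rcons m 1%N) = 0.

Lemma ev_nil : ev [::] = 0. Proof. by rewrite /ev horner_Poly. Qed.
Lemma ev_cons a s : ev (a :: s) = a%:R + x * ev s.
Proof. by rewrite /ev !horner_Poly /= addrC mulrC. Qed.

Lemma natr_modn a : (a %% p)%N%:R = a%:R :> R.
Proof. by rewrite [in RHS](divn_eq a p) natrD natrM pR mulr0 add0r. Qed.

Lemma ev_add s t : ev (radd s t) = ev s + ev t.
Proof.
elim: s t => [|a s IHs] [|b t]; rewrite /= ?ev_nil ?add0r ?addr0 //.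
by rewrite !ev_cons IHs natr_modn natrD; ring.
Qed.

Lemma ev_scale a s : ev (rscale a s) = a%:R * ev s.
Proof.
elim: s => [|b s IHs]; rewrite /= ?ev_nil ?mulr0 // !ev_cons IHs natr_modn natrM.
by ring.
Qed.

Lemma ev_rcons s a : ev (rcons s a) = ev s + a%:R * x ^+ size s.
Proof.
elim: s => [|b s IHs] /=; first by rewrite ev_cons ev_nil expr0; ring.
by rewrite !ev_cons IHs exprS; ring.
Qed.

Lemma ev_opp s : ev (ropp s) = - ev s.
Proof.
rewrite ev_scale; suff -> : (p.-1)%:R = -1 :> R by rewrite mulN1r.
by apply/eqP; rewrite -subr_eq0 opprK natr1 prednK ?pR.
Qed.

(** The relation satisfied by x enters through this step. *)
Lemma ev_mulX s : ev (rmulX s) = x * ev s.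
Proof.
transitivity (ev (0%N :: s)); last by rewrite ev_cons add0r.
rewrite /rmulX; case: eqP => // szs.
have xm : x ^+ size m = ev (ropp m).
  apply/eqP; rewrite ev_opp -subr_eq0 opprK addrC -[X in _ + X]mul1r.
  by rewrite -(ev_rcons m 1) root_x.
by rewrite lastI ev_rcons size_belast szs xm ev_add ev_scale.
Qed.

Lemma ev_mul s t : ev (rmul s t) = ev s * ev t.
Proof.
elim: s => [|a s IHs]; first by rewrite ev_nil mul0r.
by rewrite /= ev_add ev_scale ev_mulX IHs ev_cons; ring.
Qed.

Lemma ev_exp s n : ev (rexp s n) = ev s ^+ n.
Proof.
elim: n => [|n IHn]; first by rewrite ev_cons ev_nil expr0; ring.
by rewrite /= ev_mul IHn exprS.
Qed.

Lemma ev_horner s t : ev (rhorner s t) = (natpoly R s).[ev t].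
Proof.
rewrite /natpoly horner_Poly.
elim: s => [|a s IHs]; first by rewrite ev_nil.
rewrite -[rhorner _ _]/(radd [:: a] (rmul t (rhorner s t))).
by rewrite ev_add ev_mul IHs ev_cons ev_nil /=; ring.
Qed.

Lemma ev_X : ev [:: 0; 1]%N = x.
Proof. by rewrite !ev_cons ev_nil; ring. Qed.

Lemma ev_frob e s : ev (rfrob e s) = ev s ^+ (p ^ e).
Proof.
by elim: e => [|e IHe]; rewrite ?expr1 //= ev_exp IHe expnSr exprM.
Qed.

Lemma ev_iter_frob e k s : ev (iter k (rfrob e) s) = ev s ^+ ((p ^ e) ^ k).
Proof.
by elim: k => [|k IHk]; rewrite ?expr1 //= ev_frob IHk expnSr exprM.
Qed.

Lemma ev_eq0 s : all (eq_op^~ 0%N) s -> ev s = 0.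
Proof.
elim: s => [|a s IHs] /=; first by rewrite ev_nil.
by case/andP=> /eqP-> /IHs evs; rewrite ev_cons evs mulr0 addr0.
Qed.

End ResArith.

Lemma in_qpoly_natpoly (F : fieldType) (h f : {poly F}) s :
  in_qpoly h (natpoly F s \Po f) = (natpoly {poly %/ h} s).[in_qpoly h f].
Proof.
rewrite in_qpoly_comp_horner /natpoly map_Poly -map_comp.
by under eq_map => a do rewrite /= rmorph_nat.
Qed.

Lemma size_natpoly_rcons (R : nzRingType) m :
  size (natpoly R (rcons m 1%N)) = (size m).+1.
Proof.
by rewrite (@PolyK _ 0) ?map_rcons ?last_rcons ?oner_neq0 // size_rcons size_map.
Qed.

Lemma monic_natpoly_rcons (R : nzRingType) m :
  natpoly R (rcons m 1%N) \is monic.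
Proof.
rewrite monicE lead_coefE size_natpoly_rcons coef_Poly map_rcons nth_rcons.
by rewrite size_map ltnn eqxx.
Qed.

Section Modulo.
Variables (F : finFieldType) (p e : nat) (m : seq nat).
Hypotheses (p_gt0 : (0 < p)%N) (pF : p%:R = 0 :> F) (cardF : #|F| = (p ^ e)%N).
Hypothesis m_gt0 : (0 < size m)%N.
Local Notation h := (natpoly F (rcons m 1%N)).
Local Notation K := {poly %/ h}.

Let pK : p%:R = 0 :> K.
Proof. by rewrite -(rmorph_nat (qpolyC h)) pF rmorph0. Qed.

Let res_eq0 f : (in_qpoly h f == 0) = (h %| f).
Proof.
by apply: in_qpoly_eq0; rewrite ?size_natpoly_rcons ?monic_natpoly_rcons.
Qed.

Let root_qX : (natpoly K (rcons m 1%N)).['qX] = 0.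
Proof.
by rewrite -in_qpoly_natpoly comp_polyXr; apply/eqP; rewrite res_eq0.
Qed.

Lemma res_trace n :
  in_qpoly h (trace_poly F n) = (natpoly K (rtrace p m e n)).['qX].
Proof.
elim: n => [|n IHn]; first by rewrite /trace_poly big_ord0 ev_nil rmorph0.
rewrite /trace_poly big_ord_recr rmorphD /= -/(trace_poly F n) IHn.
by rewrite ev_add // ev_iter_frob // ev_X rmorphXn /= cardF.
Qed.

Lemma res_M n : in_qpoly h (M_poly F n) = (natpoly K (rM p m e n)).['qX].
Proof.
elim: n => [|n IHn]; first by rewrite ev_nil rmorph0.
rewrite -[rM _ _ _ _]/(radd p [:: 1%N]
  (ropp p (rmul p m (rtrace p m e n) (rM p m e n)))).
rewrite ev_add // ev_opp // ev_mul // -res_trace -IHn ev_cons ev_nil mulr0 addr0.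
by rewrite rmorphB rmorphM rmorph1.
Qed.

Lemma res_artin_schreier :
  in_qpoly h (artin_schreier F) =
  (natpoly K (radd p (rfrob p m e [:: 0; 1]%N) (ropp p [:: 0; 1]%N))).['qX].
Proof.
by rewrite ev_add // ev_frob // ev_opp // ev_X rmorphB rmorphXn /= cardF.
Qed.

Lemma dvd_trace_poly n :
  all (eq_op^~ 0%N) (rtrace p m e n) -> h %| trace_poly F n.
Proof. by move=> z; rewrite -res_eq0 res_trace ev_eq0. Qed.

Lemma dvd_M_poly n : all (eq_op^~ 0%N) (rM p m e n) -> h %| M_poly F n.
Proof. by move=> z; rewrite -res_eq0 res_M ev_eq0. Qed.

Lemma dvd_natpoly_artin_schreier s :
  all (eq_op^~ 0%N)
    (rhorner p m s (radd p (rfrob p m e [:: 0; 1]%N) (ropp p [:: 0; 1]%N))) ->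
  h %| natpoly F s \Po artin_schreier F.
Proof.
move=> z; rewrite -res_eq0 in_qpoly_natpoly res_artin_schreier.
by rewrite -(ev_horner p_gt0 pK root_qX) ev_eq0.
Qed.

End Modulo.

(** Induction on the degree; irreducibility is decidable over a finite field. *)
Lemma monic_irreducible_factor (F : finFieldType) (f : {poly F}) :
  (1 < size f)%N ->
  exists Q, [/\ Q \is monic, irreducible_poly Q & Q %| f].
Proof.
have [n] := ubnP (size f); elim: n f => // n IHn f le_fn f_gt1.
have [/irreducibleP f_irr | ] := boolP (irreducibleb f).
  have f_nz : lead_coef f != 0 by rewrite lead_coef_eq0 irredp_neq0.
  have eqf : (lead_coef f)^-1 *: f %= f by rewrite eqp_scale // invr_eq0.
  exists ((lead_coef f)^-1 *: f); split; last by rewrite (eqp_dvdl _ eqf).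
    by rewrite monicE lead_coefZ mulVf.
  split=> [|g sg]; first by rewrite (eqp_size eqf).
  by rewrite (eqp_dvdr _ eqf) (eqp_rtrans eqf); apply: f_irr.
rewrite /irreducibleb f_gt1 /= => /forallPn[g].
rewrite negb_imply -dvdpE -ltnNge => /andP[gf g_gt1].
have lt_gf : (size g < size f)%N.
  by rewrite (leq_ltn_trans (size_npoly g)) // ltn_predL (ltn_trans _ f_gt1).
have [|Q [Qm Qi Qg]] := IHn g _ g_gt1; first exact: leq_trans lt_gf _.
by exists Q; split=> //; apply: dvdp_trans gf.
Qed.

(** By Bezout, some multiple of a exceeds a multiple of b by one. *)
Lemma expn_fixed_coprime (R : nzRingType) (x : R) q a b :
  (0 < a)%N -> coprime a b ->
  x ^+ (q ^ a) = x -> x ^+ (q ^ b) = x -> x ^+ q = x.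
Proof.
move=> a_gt0 /(coprimeP _ a_gt0)[[u v] /= uv] xa xb.
have fixM c k : x ^+ (q ^ c) = x -> x ^+ (q ^ (k * c)) = x.
  by move=> xc; elim: k => [|k IHk]; rewrite ?expr1 // mulSn expnD exprM xc.
have ua : (u * a = v * b + 1)%N.
  by rewrite -uv subnKC // ltnW // -subn_gt0 uv.
by rewrite -[RHS](fixM a u xa) ua addn1 expnSr exprM (fixM b).
Qed.

Lemma prod_coprime_dvd (F : fieldType) (s : seq {poly F}) (G : {poly F}) :
  uniq s -> {in s, forall Q, [/\ Q \is monic, irreducible_poly Q & Q %| G]} ->
  \prod_(Q <- s) Q %| G.
Proof.
elim: s => [|Q s IHs]; first by rewrite big_nil dvd1p.
case/andP=> Qs s_uniq sP; rewrite big_cons Gauss_dvdp; last first.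
  rewrite big_seq; apply: (big_ind (coprimep Q)) => [|f g|R Rs].
  - exact: coprimep1.
  - by rewrite coprimepMr => -> ->.
  have [Qm Qi _] := sP Q (mem_head _ _); have [|Rm Ri _] := sP R.
    by rewrite inE Rs orbT.
  rewrite irreducible_poly_coprime //; apply: contraNN Qs => QR.
  suff -> : Q = R by [].
  apply/eqP; rewrite -eqp_monic //; apply: Ri => //.
  by case: Qi => /ltn_eqF; rewrite eq_sym => ->.
have [_ _ ->] := sP Q (mem_head _ _); apply: IHs => // R Rs.
by apply: sP; rewrite inE Rs orbT.
Qed.

(** * The polynomial G and its factors *)

(** The coefficients modulo 19, constant term first and leading term 1 omitted,
of mu and of the translate P0 of P whose coefficients lie in the prime
field. *)
Definition mu_tail : seq nat := [:: 10; 15; 3; 5; 0].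
Definition P0_tail : seq nat := [:: 15; 10; 3; 13; 0].

Section Example.
Variable F : finFieldType.
Hypothesis cardF : #|F| = (19 ^ 3)%N.
Local Notation q := #|F|.
Local Notation G := (G5 F).
Local Notation P0 := (natpoly F (rcons P0_tail 1%N)).

Lemma char19 : 19%:R = 0 :> F.
Proof. exact: pcharf0 (card_finPcharP cardF isT). Qed.

Lemma char19_poly : 19%:R = 0 :> {poly F}.
Proof. by rewrite -(rmorph_nat (@polyC F)) char19. Qed.

Lemma mu_natpoly : mu F = natpoly F (rcons mu_tail 1%N).
Proof.
rewrite /natpoly /= !cons_poly_def !polyC_natr.
rewrite (_ : mu F = mu F + 19%:R * ('X + 1)); last first.
  by rewrite char19_poly mul0r addr0.
by rewrite /mu; ring.
Qed.

Lemma G_natpoly : G = natpoly F (rcons mu_tail 1%N) \Po artin_schreier F.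
Proof. by rewrite -mu_natpoly. Qed.

Lemma G_dvd_bracket : G %| bracket F 5.
Proof.
rewrite G_natpoly bracket_comp; apply: dvdp_comp_poly.
by apply: (@dvd_trace_poly F 19 3 mu_tail isT char19 cardF isT); vm_compute.
Qed.

Lemma G_dvd_M : G %| M F 5.
Proof.
rewrite G_natpoly M_comp; apply: dvdp_comp_poly.
by apply: (@dvd_M_poly F 19 3 mu_tail isT char19 cardF isT); vm_compute.
Qed.

Lemma P0_dvd_G : P0 %| G.
Proof.
rewrite G_natpoly.
apply: (@dvd_natpoly_artin_schreier F 19 3 P0_tail isT char19 cardF isT).
by vm_compute.
Qed.

Lemma G_translate a : G \Po ('X - a%:P) = G.
Proof. by rewrite /G5 -comp_polyA artin_schreier_translate. Qed.

Lemma size_artin_schreier : size (artin_schreier F) = q.+1.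
Proof. by rewrite size_Xn_subX ?finNzRing_gt1. Qed.

Lemma monic_G : G \is monic.
Proof.
have q_gt1 : (1 < q)%N := finNzRing_gt1 F.
rewrite monicE G_natpoly lead_coef_comp; last first.
  by rewrite size_artin_schreier ltnS ltnW.
rewrite (eqP (monic_natpoly_rcons _ _)) mul1r.
by rewrite lead_coefDl ?lead_coefXn ?expr1n // size_polyXn size_polyN size_polyX.
Qed.

Lemma size_G : size G = (5 * q).+1.
Proof.
rewrite -[LHS]prednK ?size_poly_gt0 ?monic_neq0 ?monic_G // G_natpoly.
by rewrite size_comp_poly size_natpoly_rcons size_artin_schreier.
Qed.

(** The class of T modulo Q is fixed by the powers q^5 and q^(deg Q).  If these
exponents were coprime it would be fixed by the q-th power, which would make
mu(0) vanish modulo Q. *)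
Lemma dvd5_degree_factor (Q : {poly F}) :
  Q \is monic -> irreducible_poly Q -> Q %| G -> (5 %| (size Q).-1)%N.
Proof.
move=> Qm Qi QG; apply: contraT => ndvd.
pose K := {poly %/ Q with (Qi, Qm) : monic_irreducible_poly Q}.
pose t : K := in_qpoly Q 'X.
have fixt n : Q %| bracket F n -> t ^+ (q ^ n) = t.
  rewrite -(res_eq0 Qi Qm) rmorphB rmorphXn /= subr_eq0; exact: eqP.
have tq : t ^+ q = t.
  apply: (@expn_fixed_coprime K t q 5 (size Q).-1) => //.
  - by rewrite prime_coprime.
  - by apply/fixt/(dvdp_trans QG G_dvd_bracket).
  by apply: fixt; apply: (dvd_expq_subr Qi Qm 'X).
have u0 : in_qpoly Q (artin_schreier F) = 0.
  by rewrite rmorphB rmorphXn /=; apply/eqP; rewrite subr_eq0; apply/eqP.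
have ten0 : 10%:R = 0 :> K.
  transitivity (in_qpoly Q G : K); last by apply/eqP; rewrite (res_eq0 Qi Qm).
  rewrite G_natpoly in_qpoly_natpoly u0 horner_Poly /=.
  by rewrite mulr0 add0r.
(* Modulo 19, the constant term of mu is 10. *)
have : (1 : K) = 2 * 10%:R - 19%:R by ring.
have -> : 19%:R = 0 :> K.
  by rewrite -(rmorph_nat (in_qpoly Q)) char19_poly rmorph0.
by rewrite ten0 mulr0 subr0; move/eqP; rewrite oner_eq0.
Qed.

Lemma irreducible_of_dvd_G (P : {poly F}) :
  P %| G -> size P = 6%N -> irreducible_poly P.
Proof.
move=> PG sP; split=> [|f sf fP]; first by rewrite sP.
have P_nz : P != 0 by rewrite -size_poly_gt0 sP.
have f_gt1 : (1 < size f)%N.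
  rewrite ltn_neqAle eq_sym sf size_poly_gt0.
  by apply: contraTneq fP => ->; rewrite dvd0p.
have [Q [Qm Qi Qf]] := monic_irreducible_factor f_gt1.
have Q_gt1 : (1 < size Q)%N by case: Qi.
have d_gt0 : (0 < (size Q).-1)%N by rewrite -subn1 subn_gt0.
have f_nz : f != 0 by rewrite -size_poly_gt0 ltnW.
rewrite -(dvdp_size_eqp fP) eqn_leq dvdp_leq // sP.
apply: leq_trans (dvdp_leq f_nz Qf); rewrite -[size Q]prednK ?(ltnW Q_gt1) //.
apply: dvdn_leq d_gt0 (dvd5_degree_factor Qm Qi _).
exact: dvdp_trans Qf (dvdp_trans fP PG).
Qed.

Lemma P0_translate (b : F) :
  P0 \Po ('X - b%:P) =
  'X^5 + (- (5 * b))%:P * 'X^4 + (10 * b ^+ 2 + 13)%:P * 'X^3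
  + (- (10 * b ^+ 3) - 39 * b + 3)%:P * 'X^2
  + (5 * b ^+ 4 + 39 * b ^+ 2 - 6 * b + 10)%:P * 'X
  + (- b ^+ 5 - 13 * b ^+ 3 + 3 * b ^+ 2 - 10 * b + 15)%:P.
Proof.
rewrite /natpoly /= !cons_poly_def.
rewrite !(comp_polyD, comp_polyM, comp_polyX, comp_polyC, comp_poly0).
rewrite !(polyCD, polyCM, polyCN, polyCB, polyC_exp, polyC_natr, polyC0, polyC1).
ring.
Qed.

Section Translates.
Variable c : F.
Hypothesis def_c : c ^+ 3 = 8 * c ^+ 2 + 4 * c + 11.
(* The shift that removes the term in T^4: 5 b is the opposite of the
   coefficient 11 + 17 c + 9 c^2 of P modulo 19. *)
Let b : F := 13 + 8 * c + 2 * c ^+ 2.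

Lemma eq_mod19 (x y z : F) : x = y + 19 * z -> x = y.
Proof. by rewrite char19 mul0r addr0. Qed.

(** The powers of b are reduced one after the other, so that the multiples of 19
to be discarded remain small. *)
Lemma P5_translate : P5 c = P0 \Po ('X - b%:P).
Proof.
have b2 : b ^+ 2 = 18 + 14 * c + 17 * c ^+ 2.
  apply: (@eq_mod19 _ _ (45 + 26 * c + 33 * c ^+ 2)); rewrite /b; ring: def_c.
have b3 : b ^+ 3 = 14 + 12 * c + 3 * c ^+ 2.
  apply: (@eq_mod19 _ _ (264 + 128 * c + 210 * c ^+ 2)).
  by rewrite exprS b2 /b; ring: def_c.
have b4 : b ^+ 4 = 3 + 15 * c + 5 * c ^+ 2.
  apply: (@eq_mod19 _ _ (65 + 37 * c + 50 * c ^+ 2)).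
  by rewrite exprS b3 /b; ring: def_c.
have b5 : b ^+ 5 = 17 + 17 * c + 6 * c ^+ 2.
  apply: (@eq_mod19 _ _ (88 + 48 * c + 75 * c ^+ 2)).
  by rewrite exprS b4 /b; ring: def_c.
rewrite P0_translate b5 b4 b3 b2 /P5 /b.
congr ('X^5 + _%:P * 'X^4 + _%:P * 'X^3 + _%:P * 'X^2 + _%:P * 'X + _%:P).
- by apply: (@eq_mod19 _ _ (4 + 3 * c + c ^+ 2)); ring.
- by apply: (@eq_mod19 _ _ (-10 - 7 * c - 8 * c ^+ 2)); ring.
- by apply: (@eq_mod19 _ _ (34 + 23 * c + 6 * c ^+ 2)); ring.
- by apply: (@eq_mod19 _ _ (- 34 - 30 * c - 35 * c ^+ 2)); ring.
by apply: (@eq_mod19 _ _ (14 + 12 * c + c ^+ 2)); ring.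
Qed.

Local Notation Pt a := (P5 c \Po ('X - a%:P)).

Lemma translateE a : Pt a = P0 \Po ('X - (a + b)%:P).
Proof.
rewrite P5_translate -comp_polyA comp_polyB comp_polyX comp_polyC.
by rewrite polyCD opprD addrA.
Qed.

(** The coefficient of T^4 in P(T - a) is - 5 (a + b), and 5 is invertible modulo
19, with inverse 4. *)
Lemma translate_inj : injective (fun a => Pt a).
Proof.
move=> a a' /=; rewrite !translateE !P0_translate => /(congr1 (coefp 4)) /=.
rewrite !coefE /= !(mulr0, mulr1, addr0, add0r) => /oppr_inj eq5.
apply: (@addIr _ b).
have five e : e = 4 * (5 * e) :> F by apply: (@eq_mod19 _ _ (- e)); ring.
by rewrite (five (a + b)) eq5 -five.
Qed.

Lemma size_translate a : size (Pt a) = 6%N.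
Proof.
by rewrite translateE size_comp_poly2 ?size_XsubC // size_natpoly_rcons.
Qed.

Lemma monic_translate a : Pt a \is monic.
Proof.
rewrite translateE monicE lead_coef_comp ?size_XsubC //.
by rewrite lead_coefXsubC expr1n mulr1 -monicE monic_natpoly_rcons.
Qed.

Lemma translate_dvd_G a : Pt a %| G.
Proof.
by rewrite translateE -(G_translate (a + b)) dvdp_comp_poly // P0_dvd_G.
Qed.

Lemma translate_irr a : irreducible_poly (Pt a).
Proof. exact: irreducible_of_dvd_G (translate_dvd_G a) (size_translate a). Qed.

Lemma translate_Wieferich a : c_Wieferich (Pt a).
Proof.
apply: Wieferich_criterion; [exact: monic_translate | exact: translate_irr |].
by rewrite size_translate (dvdp_trans (translate_dvd_G a)) ?G_dvd_M.
Qed.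

Lemma G_prod : G = \prod_(a : F) Pt a.
Proof.
have prod_dvd : \prod_a Pt a %| G.
  rewrite -big_enum -(big_map (fun a => Pt a) predT id) /=.
  apply: prod_coprime_dvd => [|_ /mapP[a _ ->]].
    by rewrite map_inj_uniq ?enum_uniq //; exact: translate_inj.
  split; [exact: monic_translate | exact: translate_irr |].
  exact: translate_dvd_G.
apply/esym/eqP; rewrite -eqp_monic ?monic_G ?monic_prod // => [|a _]; last first.
  exact: monic_translate.
rewrite -(dvdp_size_eqp prod_dvd) size_prod => [|a _]; last first.
  exact: monic_neq0 (monic_translate a).
under eq_bigr => a _ do rewrite size_translate.
rewrite sum_nat_const size_G subSn ?leq_pmulr //.
by rewrite -[6%N]add1n mulnDr muln1 addKn mulnC.
Qed.

End Translates.
End Example.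

Theorem theorem4p1 (F : finFieldType) (c : F)
    (cardF : #|F| = (19 ^ 3)%N)
    (def_c : c ^+ 3 = 8 * c ^+ 2 + 4 * c + 11) :
  [/\ G5 F = \prod_(a : F) (P5 c \Po ('X - a%:P)),
      squarefree (G5 F),
      size (G5 F) = (5 * 19 ^ 3).+1,
      exists s : seq {poly F},
        [/\ size s = (19 ^ 3)%N,
            uniq s,
            forall Q : {poly F}, Q \in s -> c_Wieferich Q /\ size Q = 6%N
          & G5 F = \prod_(Q <- s) Q]
    & [/\ G5 F %| bracket F 5,
          G5 F %| M F 5
        & G5 F %| gcdp (bracket F 5) (M F 5)]].
Proof.
have G_bracket := G_dvd_bracket cardF; have G_M := G_dvd_M cardF.
split.
- exact: G_prod.
- exact: squarefree_coprime_deriv (coprime_deriv_bracket _ G_bracket).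
- by rewrite size_G // cardF.
- exists [seq P5 c \Po ('X - a%:P) | a <- enum F]; split.
  + by rewrite size_map -cardE.
  + by rewrite map_inj_uniq ?enum_uniq //; apply: translate_inj.
  + move=> _ /mapP[a _ ->]; split; last exact: size_translate.
    exact: translate_Wieferich.
  by rewrite big_map big_enum /= -G_prod.
by split; rewrite // dvdp_gcd G_bracket.
Qed.
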